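(* Suppose $a,c>0$ and $\{q_n\}_{n=0}^{\infty}$ is any nonnegative sequence. Let $$q_{a,c}(\mu;x)=\sum_{n=0}^{\infty}q_n\frac{\Gamma(a+\mu+n)}{(c+\mu)_n}\frac{x^n}{n!},\qquad \rho_{a,c}(\mu,\nu;x)=q_{a,c}(\mu;x)q_{a,c}(\nu;x)-q_{a,c}(0;x)q_{a,c}(\mu+\nu;x).$$ Then, provided $\{q_n\}$ is not identically zero, the function $\mu\mapsto q_{a,c}(\mu;x)$ is strictly log-convex on $[0,\infty)$ for each fixed $x>0$. Moreover, the family $\{q_{a,c}(\mu;x)\}_{\mu\geq0}$ is Wright $q$-log-convex, i.e. $\rho_{a,c}(\mu,\nu;x)$ has non-positive power series coefficients (in powers of $x$) for all $\mu,\nu\geq0$, so that $x\mapsto-\rho_{a,c}(\mu,\nu;x)$ is absolutely monotonic and multiplicatively convex on $(0,\infty)$.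
   Context: $(a)_0=1$, $(a)_n=a(a+1)\cdots(a+n-1)$ is the rising factorial. A function $F:[0,\infty)\to(0,\infty)$ is strictly log-convex if $F(\lambda\mu+(1-\lambda)\nu)<F(\mu)^{\lambda}F(\nu)^{1-\lambda}$ for all $\mu\neq\nu$ in $[0,\infty)$ and $\lambda\in(0,1)$. A family $\{f(\mu;x)\}_{\mu\ge0}$ of formal power series in $x$ whose coefficients are nonnegative continuous functions of $\mu$ is Wright $q$-log-convex if $f(\mu+\alpha;x)f(\mu+\beta;x)-f(\mu;x)f(\mu+\alpha+\beta;x)$ has non-positive coefficients at all powers of $x$ for all $\mu,\alpha,\beta\ge0$. A function is absolutely monotonic on an interval if it and all its derivatives are nonnegative there. A nonnegative function $\phi$ is multiplicatively convex if $\phi(x^{\lambda}y^{1-\lambda})\le\phi(x)^{\lambda}\phi(y)^{1-\lambda}$ for all $x,y$ in the interval and $\lambda\in[0,1]$. Power series are understood as formal; assertions about values at fixed $x$, or about functions of $x$ on $(0,\infty)$, are understood for those $x>0$ in the interval of convergence of the series. *)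

(* Defs.v *)
From HB Require Import structures.
From mathcomp Require Import all_boot all_order all_algebra.
From mathcomp Require Import all_classical all_reals all_analysis.
Import Order.TTheory GRing.Theory Num.Theory.
Import numFieldNormedType.Exports.

Set Implicit Arguments.
Unset Strict Implicit.
Unset Printing Implicit Defensive.

Local Open Scope classical_set_scope.
Local Open Scope ring_scope.

Section Notions.
Context {R : realType}.
Implicit Types (a c s x y lam mu nu alpha beta : R) (n : nat).

Definition rising a n : R := \prod_(i < n) (a + i%:R).

(** Euler's integral; it converges exactly for [0 < s]. *)
Definition Gamma s : R :=
  \int[lebesgue_measure]_(t in `]0%R, +oo[) (t `^ (s - 1) * expR (- t)).

Definition strictly_log_convex (F : R -> R) : Prop :=
  (forall mu, 0 <= mu -> 0 < F mu) /\
  (forall mu nu lam, 0 <= mu -> 0 <= nu -> mu != nu -> 0 < lam -> lam < 1 ->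
     F (lam * mu + (1 - lam) * nu) < F mu `^ lam * F nu `^ (1 - lam)).

(** A formal power series is the sequence of its coefficients; its value where
    it converges is the limit of the partial sums [pseries]. *)
Definition fps_mul (f g : nat -> R) n : R := \sum_(i < n.+1) f i * g (n - i)%N.

Definition fps_eval (f : nat -> R) x : R := limn (pseries f x).

Definition wright_q_log_convex (f : R -> nat -> R) : Prop :=
  [/\ forall mu n, 0 <= mu -> 0 <= f mu n,
      forall n, {within [set` `[0%R, +oo[], continuous (fun mu => f mu n)}
    & forall mu alpha beta n, 0 <= mu -> 0 <= alpha -> 0 <= beta ->
        fps_mul (f (mu + alpha)) (f (mu + beta)) n
        - fps_mul (f mu) (f (mu + alpha + beta)) n <= 0].

(** The intervals of interest may contain their right endpoint, where a power
    series may converge without being differentiable; derivatives are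
    therefore taken at interior points only. *)
Definition absolutely_monotonic (D : set R) (phi : R -> R) : Prop :=
  (forall x, D x -> 0 <= phi x) /\
  (forall n x, D° x ->
     derivable (derive1n n phi) x 1 /\ 0 <= derive1n n.+1 phi x).

Definition multiplicatively_convex (D : set R) (phi : R -> R) : Prop :=
  (forall x, D x -> 0 <= phi x) /\
  (forall x y lam, D x -> D y -> 0 <= lam -> lam <= 1 ->
     phi (x `^ lam * y `^ (1 - lam)) <= phi x `^ lam * phi y `^ (1 - lam)).

Definition q_fps a c (q : nat -> R) mu n : R :=
  q n * (Gamma (a + mu + n%:R) / rising (c + mu) n) / n`!%:R.

Definition q_fun a c (q : nat -> R) mu x : R := fps_eval (q_fps a c q mu) x.

Definition rho_fps a c (q : nat -> R) mu nu n : R :=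
  fps_mul (q_fps a c q mu) (q_fps a c q nu) n
  - fps_mul (q_fps a c q 0) (q_fps a c q (mu + nu)) n.

Definition rho_fun a c (q : nat -> R) mu nu x : R :=
  q_fun a c q mu x * q_fun a c q nu x
  - q_fun a c q 0 x * q_fun a c q (mu + nu) x.

(** The positive part of the interval of convergence. Since
    [Gamma (a + mu + n) / rising (c + mu) n] is equivalent to
    [Gamma (c + mu) * n `^ (a - c)] as [n] tends to infinity, convergence at [x]
    for one [mu >= 0] is the same as convergence for all of them. *)
Definition conv_interval a c (q : nat -> R) : set R :=
  [set x | 0 < x /\ forall mu, 0 <= mu -> cvgn (pseries (q_fps a c q mu) x)].

End Notions.

(* Main.v *)
Require Import Defs.
From HB Require Import structures.
From mathcomp Require Import all_boot all_order all_algebra.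
From mathcomp Require Import all_classical all_reals all_analysis.
From mathcomp Require Import measurable_realfun ring lra.
Import Order.TTheory GRing.Theory Num.Theory.
Import numFieldNormedType.Exports.
Local Open Scope classical_set_scope.
Local Open Scope ring_scope.

Set Implicit Arguments.
Unset Strict Implicit.
Unset Printing Implicit Defensive.

(** Write the coefficient of [x ^+ n] as [q n / n`! * g n mu] with
    [g n mu = Gamma (a + mu + n) / rising (c + mu) n]. Everything follows from
    one fact about a single coefficient: [g n] is strictly log-convex in [mu].
    This holds because Gamma is strictly log-convex on the positive reals and
    the rising factorial, a product of affine functions, is log-concave
    ([gamma_ratio_strictly_log_convex]).

    Strict log-convexity of Gamma ([Gamma_conv_lt]) and of the sum of the series
    ([q_fun_strictly_log_convex]) are both instances of Hoelder's inequality,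
    proved by integrating or summing the weighted arithmetic-geometric mean
    inequality for the normalized quantities [u / U] and [v / V]
    ([hoelder_pointwise]). This form makes strictness visible: a strict
    inequality at one term of a series, or at all but one point of the half
    line, survives the summation.

    For the signs of the coefficients of the product, group the terms of
    indices [i] and [n - i]. If [F] and [G] are log-convex, then
    [t |-> F (mu + t) * G (mu + s - t)] is log-convex, hence convex, and so is
    its symmetrization in [F] and [G], which is moreover symmetric about
    [s / 2]; a convex function symmetric about the middle of an interval is
    largest at the ends. That is [log_convex_pair], and summing it over [i]
    gives Wright log-convexity of the coefficients ([q_fps_wright]).

    Finally, the Cauchy product of nonnegative convergent series converges to
    the product of the sums, so [- rho_fun] is on the whole interval of
    convergence the sum of a power series with nonnegative coefficients. Such a
    sum is absolutely monotonic, by termwise differentiation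
    ([represented_absolutely_monotonic]), and multiplicatively convex, by
    Hoelder's inequality for series
    ([represented_multiplicatively_convex]). *)

(** * Weighted arithmetic-geometric mean inequality *)

Section AMGM.
Context {R : realType}.
Implicit Types x y u v l : R.

(** The graph of [expR] lies above its tangent at the mean [m], strictly away
    from [m]; averaging the tangent inequality at [u] and [v] cancels the linear
    term. *)
Lemma expR_conv_lt u v l : u != v -> 0 < l -> l < 1 ->
  expR (l * u + (1 - l) * v) < l * expR u + (1 - l) * expR v.
Proof.
move=> uv l0 l1; set m := l * u + (1 - l) * v.
(* Factor out the value at the mean, so that the tangent is taken at 0. *)
have -> : expR u = expR m * expR (u - m) by rewrite -expRD; congr expR; ring.
have -> : expR v = expR m * expR (v - m) by rewrite -expRD; congr expR; ring.
have um : u - m != 0.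
  have -> : u - m = (1 - l) * (u - v) by rewrite /m; ring.
  by rewrite mulf_neq0// subr_eq0 // gt_eqF.
have := expR_gt1Dx um; have := expR_ge1Dx (v - m); have := expR_gt0 m.
set e := expR m; set p := expR _; set q := expR _ => e0 hq hp.
have h : 1 < l * q + (1 - l) * p.
  have : l * (1 + (u - m)) + (1 - l) * (1 + (v - m)) = 1 by rewrite /m; ring.
  move=> {1}<-; apply: ltr_leD; first by rewrite ltr_pM2l.
  by apply: ler_wpM2l; rewrite // subr_ge0 ltW.
have -> : l * (e * q) + (1 - l) * (e * p) = e * (l * q + (1 - l) * p) by ring.
by rewrite ltr_pMr.
Qed.

Lemma weighted_amgm_lt x y l : 0 < x -> 0 < y -> x != y -> 0 < l -> l < 1 ->
  x `^ l * y `^ (1 - l) < l * x + (1 - l) * y.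
Proof.
move=> x0 y0 xy l0 l1.
have lnxy : ln x != ln y.
  by apply: contra_neq xy => /ln_inj; apply; rewrite posrE.
have := expR_conv_lt lnxy l0 l1.
by rewrite expRD !lnK ?posrE// /powR !gt_eqF.
Qed.

Lemma powR_conv_id x l : 0 <= x -> x `^ l * x `^ (1 - l) = x.
Proof.
rewrite le_eqVlt => /predU1P[<-|x0].
  have [->|l0] := eqVneq l 0; first by rewrite powRr0 subr0 powRr1// mulr0.
  by rewrite powR0// mul0r.
rewrite -powRD; first by rewrite addrC subrK powRr1// ltW.
by rewrite (gt_eqF x0) implybT.
Qed.

Lemma weighted_amgm x y l : 0 <= x -> 0 <= y -> 0 <= l -> l <= 1 ->
  x `^ l * y `^ (1 - l) <= l * x + (1 - l) * y.
Proof.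
move=> x0 y0 l0 l1.
have [->|ln0] := eqVneq l 0.
  by rewrite powRr0 subr0 powRr1// !mul1r mul0r add0r.
have [->|ln1] := eqVneq l 1.
  by rewrite subrr powRr0 powRr1// mulr1 mul1r mul0r addr0.
have {}l0 : 0 < l by rewrite lt_def ln0.
have {ln1}l1 : l < 1 by rewrite lt_def eq_sym ln1.
have hl : 0 <= 1 - l by rewrite subr_ge0 ltW.
have [->|xn0] := eqVneq x 0.
  by rewrite powR0 ?gt_eqF// mul0r mulr0 add0r mulr_ge0.
have [->|yn0] := eqVneq y 0.
  by rewrite (powR0 (x := 1 - l)) ?subr_eq0 ?gt_eqF// !mulr0 addr0 mulr_ge0 // ltW.
have [<-|xy] := eqVneq x y.
  by rewrite powR_conv_id// -mulrDl addrC subrK mul1r.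
by apply/ltW/weighted_amgm_lt => //; rewrite lt_def ?xn0 ?yn0.
Qed.

Lemma powR_div x y l : 0 <= x -> 0 < y -> (x / y) `^ l = x `^ l / y `^ l.
Proof.
move=> x0 y0; have yV : 0 <= y^-1 by rewrite invr_ge0 ltW.
by rewrite (powRM _ x0 yV) -(powR_inv1 (ltW y0)) -powRrM mulN1r powRN.
Qed.

Lemma powR_mix_div u v (U V : R) l : 0 <= u -> 0 <= v -> 0 < U -> 0 < V ->
  U `^ l * V `^ (1 - l) * ((u / U) `^ l * (v / V) `^ (1 - l)) = u `^ l * v `^ (1 - l).
Proof.
move=> u0 v0 U0 V0; rewrite !powR_div//.
have := @powR_gt0 _ U l U0; have := @powR_gt0 _ V (1 - l) V0.
move: (U `^ l) (V `^ _) => A B B0 A0; field.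
by rewrite !gt_eqF.
Qed.

(** Hoelder's inequality before integration. With [U] and [V] the integrals
    (or sums) of [u] and [v], the right-hand side integrates to
    [U `^ l * V `^ (1 - l)]. *)
Lemma hoelder_pointwise u v (U V : R) l :
  0 <= u -> 0 <= v -> 0 < U -> 0 < V -> 0 <= l -> l <= 1 ->
  u `^ l * v `^ (1 - l) <=
  U `^ l * V `^ (1 - l) * (l * (u / U) + (1 - l) * (v / V)).
Proof.
move=> u0 v0 U0 V0 l0 l1; rewrite -(powR_mix_div _ u0 v0 U0 V0).
rewrite ler_wpM2l ?mulr_ge0 ?powR_ge0//.
by apply: weighted_amgm; rewrite ?divr_ge0// ltW.
Qed.

(** Strictness is lost only where [u] and [v] are in the ratio of [U] to
    [V]. *)
Lemma hoelder_pointwise_lt u v (U V : R) l :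
  0 < u -> 0 < v -> 0 < U -> 0 < V -> 0 < l -> l < 1 -> u / U != v / V ->
  u `^ l * v `^ (1 - l) <
  U `^ l * V `^ (1 - l) * (l * (u / U) + (1 - l) * (v / V)).
Proof.
move=> u0 v0 U0 V0 l0 l1 neq; rewrite -(powR_mix_div _ (ltW u0) (ltW v0) U0 V0).
rewrite ltr_pM2l ?mulr_gt0 ?powR_gt0//.
by apply: weighted_amgm_lt; rewrite ?divr_gt0.
Qed.

End AMGM.

(** * Convergence of Euler's integral *)

Section GammaIntegral.
Context {R : realType}.
Implicit Types s t x y l : R.
Local Notation mu := (@lebesgue_measure R).
Local Notation halfline := (`]0%R, +oo[%classic : set R).

Definition gamma_integrand s t : R := t `^ (s - 1) * expR (- t).

(** The linear bound [ln y < y] at [y = t / (2 * s)] produces exactly the rate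
    [t / 2]. *)
Lemma powR_le_expR s t : 0 < s -> 0 < t ->
  t `^ s <= (2 * s) `^ s * expR (t / 2).
Proof.
move=> s0 t0; have s20 : 0 < 2 * s by rewrite mulr_gt0.
have -> : t `^ s = (2 * s) `^ s * (t / (2 * s)) `^ s.
  by rewrite -powRM ?divr_ge0 1?ltW// mulrC divfK// gt_eqF.
rewrite ler_wpM2l ?powR_ge0// /powR gt_eqF ?divr_gt0// ler_expR.
have -> : t / 2 = s * (t / (2 * s)) by field; rewrite gt_eqF.
by rewrite ler_wpM2l ?(ltW s0)// ltW// ln_sublinear// divr_gt0.
Qed.

(** Derivative of the bounded function [t |-> - (1 + t `^ s)^-1]. It has the
    order of [t `^ (s - 1)] at 0 and decays slower than [expR (- t)] at
    infinity, so that a single explicit primitive controls the integrand of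
    Gamma at both ends. *)
Definition gamma_majorant s t : R := s * t `^ (s - 1) / (1 + t `^ s) ^+ 2.

Lemma addr1_powR_gt0 s t : 0 < 1 + t `^ s.
Proof. by rewrite ltr_wpDr ?powR_ge0. Qed.

Lemma is_derive_gamma_majorant s t : 0 < t ->
  is_derive t 1 (fun t => - (1 + t `^ s)^-1) (gamma_majorant s t).
Proof.
move=> t0.
have h : 1 + t `^ s != 0 by rewrite gt_eqF ?addr1_powR_gt0.
have := is_derive1_powR s t0 => d.
apply: is_derive_eq.
rewrite /gamma_majorant /GRing.scale/=; field.
by rewrite h.
Qed.

Lemma gamma_majorant_cvg0 s : 0 < s ->
  - (1 + t `^ s)^-1 @[t --> +oo] --> (0 : R).
Proof.
move=> s0; apply/cvgr0Pnorm_lt => e e0; near=> t.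
rewrite normrN normfV gtr0_norm ?addr1_powR_gt0// invf_plt ?posrE ?addr1_powR_gt0//.
have ht : e^-1 `^ (s^-1) <= t by near: t; apply: nbhs_pinfty_ge; rewrite num_real.
have -> : e^-1 = (e^-1 `^ (s^-1)) `^ s.
  by rewrite -powRrM mulVf ?gt_eqF// powRr1// invr_ge0 ltW.
rewrite ltr_pwDl// ge0_ler_powR ?nnegrE ?powR_ge0 ?(ltW s0)//.
Unshelve. all: by end_near. Qed.

Lemma gamma_majorant_ge0 s t : 0 < s -> 0 <= gamma_majorant s t.
Proof.
by move=> s0; rewrite divr_ge0 ?exprn_ge0 ?mulr_ge0 ?powR_ge0 ?(ltW s0)// ltW ?addr1_powR_gt0.
Qed.

Lemma powR_continuous r t : 0 < t -> {for t, continuous (fun t : R => t `^ r)}.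
Proof.
move=> t0; apply: differentiable_continuous; apply/derivable1_diffP.
by have /@ex_derive := is_derive1_powR r t0.
Qed.

Lemma gamma_majorant_continuous s : {in `]0, +oo[, continuous (gamma_majorant s)}.
Proof.
move=> t; rewrite in_itv/= andbT => t0.
have c1 r := @powR_continuous r t t0.
apply: cvgM; first by apply: cvgM; [exact: cvg_cst|exact: c1].
apply: cvgV; first by rewrite expf_neq0// gt_eqF ?addr1_powR_gt0.
by apply: cvgM; (apply: cvgD; [exact: cvg_cst|exact: c1]).
Qed.

Lemma measurable_gamma_majorant s : measurable_fun halfline (gamma_majorant s).
Proof.
apply: open_continuous_measurable_fun; first exact: interval_open.
by move=> t; rewrite inE => /gamma_majorant_continuous.
Qed.

(** The bound does not depend on [e]. The lower end stays away from 0, where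
    the majorant may be unbounded. *)
Lemma integral_gamma_majorant_le s e : 0 < s -> 0 < e ->
  (\int[mu]_(t in `[e, +oo[) (gamma_majorant s t)%:E <= 1)%E.
Proof.
move=> s0 e0.
have df t : 0 < t -> derivable (fun t => - (1 + t `^ s)^-1) t 1.
  by move=> t0; have /@ex_derive := is_derive_gamma_majorant s t0.
rewrite (@ge0_continuous_FTC2y _ _ (fun t => - (1 + t `^ s)^-1) _ 0).
- by rewrite sub0e -EFinN opprK lee_fin invf_le1 ?addr1_powR_gt0// lerDl powR_ge0.
- by move=> t _; exact: gamma_majorant_ge0.
- apply/continuous_in_subspaceT => t; rewrite inE/= in_itv/= andbT => et.
  by apply: gamma_majorant_continuous; rewrite in_itv/= andbT (lt_le_trans e0).
- exact: gamma_majorant_cvg0.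
- by move=> t et; apply: df; exact: lt_trans et.
- apply: cvg_at_right_filter.
  exact: (differentiable_continuous ((derivable1_diffP _ _).1 (df _ e0))).
- move=> t; rewrite in_itv/= andbT => et; rewrite derive1E.
  by have /@derive_val := is_derive_gamma_majorant s (lt_trans e0 et).
Qed.

(** Monotone convergence along the half lines starting at [n.+1%:R^-1]. *)
Lemma integrable_gamma_majorant s : 0 < s ->
  mu.-integrable halfline (EFin \o gamma_majorant s).
Proof.
move=> s0; apply/integrableP; split.
  by apply/measurable_EFinP; exact: measurable_gamma_majorant.
pose F n : set R := `[n.+1%:R^-1, +oo[%classic.
have -> : halfline = \bigcup_n F n.
  apply/seteqP; split => t; rewrite /= in_itv/= andbT.
    move=> t0; exists (Num.truncn t^-1) => //.
    rewrite /F/= in_itv/= andbT invf_ple ?posrE// ltW//.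
    exact: truncnS_gt.
  by move=> [n _]; rewrite /F/= in_itv/= andbT; apply: lt_le_trans.
under eq_integral do rewrite /= ger0_norm ?gamma_majorant_ge0//.
apply: (@le_lt_trans _ _ 1%E); last exact: ltry.
have cv : (\int[mu]_(t in F n) (gamma_majorant s t)%:E)%E @[n --> \oo] -->
    (\int[mu]_(t in \bigcup_n F n) (gamma_majorant s t)%:E)%E.
  apply: ge0_nondecreasing_set_cvg_integral.
  - apply/nondecreasing_seqP => n; rewrite subsetEset /F; apply: subset_itvr.
    by rewrite bnd_simp lef_pV2 ?posrE// ler_nat.
  - by move=> n; exact: measurable_itv.
  - move=> n; apply/measurable_EFinP.
    apply: measurable_funS (@measurable_gamma_majorant s) => // t.
    by rewrite /F/= !in_itv/= !andbT; apply: lt_le_trans.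
  - by move=> n t _; rewrite lee_fin gamma_majorant_ge0.
rewrite -(cvg_lim _ cv)//; apply: lime_le; first exact: cvgP cv.
by apply: nearW => n; apply: integral_gamma_majorant_le; rewrite ?invr_gt0.
Qed.

End GammaIntegral.

(** * Positivity, strict log-convexity and continuity of Gamma *)

Section GammaFunction.
Context {R : realType}.
Implicit Types s t x y l : R.
Local Notation mu := (@lebesgue_measure R).
Local Notation halfline := (`]0%R, +oo[%classic : set R).

Lemma gamma_integrand_gt0 s t : 0 < t -> 0 < gamma_integrand s t.
Proof. by move=> t0; rewrite mulr_gt0 ?powR_gt0 ?expR_gt0. Qed.

(** [powR_le_expR] gives [1 + t `^ s <= K * expR (t / 2)]; the square of this
    bound is what the exponential factor of the integrand absorbs. *)
Lemma gamma_integrand_le s t : 0 < s -> 0 < t ->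
  gamma_integrand s t <= (1 + (2 * s) `^ s) ^+ 2 / s * gamma_majorant s t.
Proof.
move=> s0 t0; set K := 1 + _.
have K0 : 0 < K by exact: addr1_powR_gt0.
have tK : 1 + t `^ s <= K * expR (t / 2).
  rewrite mulrDl mul1r; apply: lerD; last exact: powR_le_expR.
  by rewrite -[leLHS]expR0 ler_expR divr_ge0// ltW.
have tK2 : (1 + t `^ s) ^+ 2 <= K ^+ 2 * expR t.
  have -> : expR t = expR (t / 2) ^+ 2 by rewrite -expRM_natl; congr expR; field.
  by rewrite -exprMn ler_sqr // nnegrE ltW ?mulr_gt0 ?expR_gt0 ?addr1_powR_gt0.
have -> : K ^+ 2 / s * gamma_majorant s t =
    gamma_integrand s t * (K ^+ 2 * expR t / (1 + t `^ s) ^+ 2).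
  rewrite /gamma_integrand /gamma_majorant expRN; field.
  by rewrite !gt_eqF ?expR_gt0 ?addr1_powR_gt0.
rewrite ler_peMr ?(ltW (gamma_integrand_gt0 _ t0))//.
by rewrite ler_pdivlMr ?mul1r// exprn_gt0 // addr1_powR_gt0.
Qed.

Lemma measurable_gamma_integrand s (D : set R) :
  measurable_fun D (gamma_integrand s).
Proof.
apply: measurable_funTS; apply: measurable_funM => //.
by apply: measurableT_comp.
Qed.

Lemma integrable_gamma s : 0 < s ->
  mu.-integrable halfline (EFin \o gamma_integrand s).
Proof.
move=> s0; pose C := (1 + (2 * s) `^ s) ^+ 2 / s.
have := @integrableZl _ _ _ mu halfline (measurable_itv _) C _
  (integrable_gamma_majorant s0).
apply: le_integrable => //.
  by apply/measurable_EFinP; exact: measurable_gamma_integrand.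
move=> t; rewrite /= in_itv/= andbT => t0; rewrite lee_fin.
rewrite gtr0_norm ?gamma_integrand_gt0// ger0_norm; first exact: gamma_integrand_le.
rewrite mulr_ge0 ?gamma_majorant_ge0// divr_ge0 ?exprn_ge0 ?(ltW s0)//.
by rewrite ltW ?addr1_powR_gt0.
Qed.

(** A null set that contains all but one point of the half line would contain
    an interval of length 1. One zero has to be tolerated because the
    Hoelder defect of two Gamma integrands vanishes at one point. *)
Lemma Rintegral_halfline_gt0 (f : R -> R) :
  mu.-integrable halfline (EFin \o f) ->
  (forall t, 0 < t -> 0 <= f t) ->
  (forall s t, 0 < s -> 0 < t -> f s = 0 -> f t = 0 -> s = t) ->
  0 < \int[mu]_(t in halfline) f t.
Proof.
move=> fi f0 f1.
have f0' t : halfline t -> 0 <= f t by rewrite /= in_itv/= andbT; exact: f0.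
rewrite lt_def Rintegral_ge0// andbT; apply/eqP => fint.
have /integrableP[mf _] := fi.
have : (\int[mu]_(t in halfline) `|(f t)%:E| = 0)%E.
  transitivity (\int[mu]_(t in halfline) (f t)%:E)%E.
    by apply: eq_integral => t; rewrite inE => /f0' h; rewrite gee0_abs.
  rewrite -[LHS]fineK; last exact: integrable_fin_num.
  by move: fint; rewrite /Rintegral => ->.
move=> /(@ae_eq_integral_abs _ _ _ mu halfline (measurable_itv _) _ mf).1[N [mN N0 subN]].
have subitv a : 0 <= a -> (forall t, a < t -> f t != 0) -> False.
  move=> a0 fa.
  have : mu `]a, (a + 1)[%classic = 0.
    apply: (subset_measure0 _ mN _ N0); first exact: measurable_itv.
    move=> t; rewrite /= in_itv/= => /andP[t1 t2].
    apply: subN => /= h; move/eqP : (fa _ t1); apply.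
    have : 0 < t by exact: le_lt_trans t1.
    by move=> t0; have := h; rewrite in_itv/= andbT t0 => /(_ isT)[].
  rewrite lebesgue_measure_itv/= lte_fin ltrDl ltr01 -EFinB addrAC subrr add0r.
  by move=> [/eqP]; rewrite oner_eq0.
have [[t [t0 ft]]|nz] := pselect (exists t, 0 < t /\ f t = 0).
  apply: (subitv t); first exact: ltW.
  move=> x tx; apply/eqP => fx; have := f1 _ _ t0 (lt_trans t0 tx) ft fx.
  by move=> e; move: tx; rewrite e ltxx.
apply: (subitv 0) => // t t0; apply/eqP => ft; apply: nz; exists t; split => //.
Qed.

Lemma Gamma_gt0 s : 0 < s -> 0 < Gamma s.
Proof.
move=> s0; apply: Rintegral_halfline_gt0; first exact: integrable_gamma.
- by move=> t t0; rewrite ltW ?gamma_integrand_gt0.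
- by move=> x t /(gamma_integrand_gt0 s) x0 _ /eqP; rewrite gt_eqF.
Qed.

(** The integrand is log-affine in the parameter, so the left-hand side of
    [hoelder_pointwise] for the integrands at [x] and [y] is the integrand at
    the mean. *)
Lemma gamma_integrand_conv x y l t : 0 < t ->
  gamma_integrand (l * x + (1 - l) * y) t =
  gamma_integrand x t `^ l * gamma_integrand y t `^ (1 - l).
Proof.
move=> t0.
have E s : gamma_integrand s t = expR ((s - 1) * ln t - t).
  by rewrite expRD /gamma_integrand /powR gt_eqF.
by rewrite !E -!expRM -expRD; congr expR; ring.
Qed.

(** Integrate [hoelder_pointwise_lt] for the integrands at [x] and [y]. Equality
    at [t] forces [t `^ (x - y) = Gamma x / Gamma y], which determines [t]. *)
Lemma Gamma_conv_lt x y l : 0 < x -> 0 < y -> x != y -> 0 < l -> l < 1 ->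
  Gamma (l * x + (1 - l) * y) < Gamma x `^ l * Gamma y `^ (1 - l).
Proof.
move=> x0 y0 xy l0 l1; have l10 : 0 < 1 - l by rewrite subr_gt0.
set m := l * x + _.
have m0 : 0 < m by rewrite addr_gt0 // mulr_gt0.
have X0 := Gamma_gt0 x0; have Y0 := Gamma_gt0 y0.
have XE : \int[mu]_(t in halfline) gamma_integrand x t = Gamma x by [].
have YE : \int[mu]_(t in halfline) gamma_integrand y t = Gamma y by [].
have -> : Gamma m = \int[mu]_(t in halfline) gamma_integrand m t by [].
move: (Gamma x) (Gamma y) X0 Y0 XE YE => X Y X0 Y0 XE YE.
set C := _ * _; have C0 : 0 < C by rewrite mulr_gt0 ?powR_gt0.
(* The coefficients for which the majorant of [hoelder_pointwise] integrates to [C]. *)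
pose p := C * l / X; pose q := C * (1 - l) / Y.
have ix := integrable_gamma x0; have iy := integrable_gamma y0.
have im := integrable_gamma m0.
have iZ r s : 0 < s -> mu.-integrable halfline
    (EFin \o (fun t => r * gamma_integrand s t)).
  move=> s0; exact: @integrableZl _ _ _ mu halfline (measurable_itv _) r _
    (integrable_gamma s0).
have iD : mu.-integrable halfline
    (EFin \o (fun t => p * gamma_integrand x t + q * gamma_integrand y t)).
  exact: @integrableD _ _ _ mu halfline (measurable_itv _) _ _
    (iZ p x x0) (iZ q y y0).
have -> : C = \int[mu]_(t in halfline)
    (p * gamma_integrand x t + q * gamma_integrand y t).
  rewrite RintegralD//; [|exact: iZ|exact: iZ].
  rewrite !RintegralZl// XE YE /p /q.
  rewrite !divfK ?(gt_eqF X0) ?(gt_eqF Y0)//.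
  by rewrite -mulrDr addrC subrK mulr1.
rewrite -subr_gt0 -RintegralB//.
have E t : 0 < t -> p * gamma_integrand x t + q * gamma_integrand y t =
  C * (l * (gamma_integrand x t / X) + (1 - l) * (gamma_integrand y t / Y)).
  by move=> t0; rewrite /p /q; ring.
apply: Rintegral_halfline_gt0.
- exact: @integrableB _ _ _ mu halfline (measurable_itv _) _ _ iD im.
- move=> t t0; rewrite subr_ge0 E// gamma_integrand_conv//.
  by apply: hoelder_pointwise; rewrite ?ltW ?gamma_integrand_gt0.
- have ratio t : 0 < t -> p * gamma_integrand x t + q * gamma_integrand y t -
      gamma_integrand m t = 0 -> t `^ (x - y) = X / Y.
    move=> t0 /eqP; rewrite subr_eq0 E// gamma_integrand_conv// => /eqP eq.
    have /eqP : gamma_integrand x t / X = gamma_integrand y t / Y.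
      apply/eqP/negPn/negP => ne.
      have := hoelder_pointwise_lt (gamma_integrand_gt0 x t0)
        (gamma_integrand_gt0 y t0) X0 Y0 l0 l1 ne.
      by rewrite -/C eq ltxx.
    rewrite /gamma_integrand eqr_div ?(gt_eqF X0) ?(gt_eqF Y0)// => /eqP h.
    have -> : x - y = (x - 1) - (y - 1) by ring.
    rewrite powRB ?(gt_eqF t0) ?implybT//; apply/eqP.
    rewrite eqr_div ?(gt_eqF Y0) ?(gt_eqF (powR_gt0 _ t0))//.
    apply/eqP; apply: (mulIf (x := expR (- t))); first by rewrite gt_eqF ?expR_gt0.
    by rewrite mulrAC h; ring.
  move=> s t s0 t0 /(ratio _ s0) hs /(ratio _ t0); rewrite -hs.
  rewrite /powR !gt_eqF// => /expR_inj /mulfI.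
  rewrite subr_eq0 => /(_ xy)/ln_inj; rewrite !posrE => /(_ t0 s0) ->//.
Qed.

Lemma powRr_continuous t : 0 < t -> continuous (fun r : R => t `^ (r - 1)).
Proof.
move=> t0.
have -> : (fun r => t `^ (r - 1)) = expR \o (fun r => (r - 1) * ln t).
  by apply/funext => u; rewrite /powR gt_eqF.
move=> r; apply: continuous_comp; last exact: continuous_expR.
by apply: cvgM; [apply: cvgB; [exact: cvg_id|exact: cvg_cst]|exact: cvg_cst].
Qed.

(** On the interval from [s / 2] to [s * 2] the integrand is dominated by the
    sum of its values at the two ends: one dominates for [t < 1], the other for
    [1 <= t]. *)
Lemma Gamma_continuous s : 0 < s -> {for s, continuous (@Gamma R)}.
Proof.
move=> s0; have s20 : 0 < s / 2 by rewrite divr_gt0.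
pose I : set R := `](s / 2), (s * 2)[%classic.
have Ilt r : I r -> s / 2 < r /\ r < s * 2 by rewrite /I/= in_itv/= => /andP[].
have Is : s \in I by rewrite inE /I /= in_itv/=; apply/andP; split; lra.
apply: (@continuity_under_integral R _ _ mu gamma_integrand halfline _
  (s / 2) (s * 2) _ _
  (fun t => gamma_integrand (s / 2) t + gamma_integrand (s * 2) t)) => //.
- by move=> r /Ilt[r1 _]; apply: integrable_gamma; exact: lt_trans r1.
- apply: aeW => t; rewrite /= in_itv/= andbT => t0 r _.
  apply: cvgM; last exact: cvg_cst.
  exact: powRr_continuous.
- have s2 : 0 < s * 2 by rewrite mulr_gt0.
  exact: @integrableD _ _ _ mu halfline (measurable_itv _) _ _
    (integrable_gamma s20) (integrable_gamma s2).
- move=> r /Ilt[r1 r2]; apply: aeW => t; rewrite /= in_itv/= andbT => t0.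
  rewrite gtr0_norm ?gamma_integrand_gt0//.
  have [t1|t1] := leP 1 t.
    rewrite ler_wpDl ?(ltW (gamma_integrand_gt0 _ t0))//.
    by rewrite ler_wpM2r ?expR_ge0// ler_powR// lerB// ltW.
  rewrite ler_wpDr ?(ltW (gamma_integrand_gt0 _ t0))//.
  rewrite ler_wpM2r ?expR_ge0//; apply: ger_powR; first by rewrite t0 ltW.
  by rewrite lerB// ltW.
Qed.

End GammaFunction.

(** * Log-convexity of the coefficients *)

Section LogConvexity.
Context {R : realType}.
Implicit Types (x y a c mu nu lam s t : R) (F G : R -> R) (q : nat -> R) (n k : nat).

Lemma strictly_log_convexW F mu nu lam : strictly_log_convex F ->
  0 <= mu -> 0 <= nu -> 0 <= lam -> lam <= 1 ->
  F (lam * mu + (1 - lam) * nu) <= F mu `^ lam * F nu `^ (1 - lam).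
Proof.
move=> [F0 FC] mu0 nu0 l0 l1.
have [->|munu] := eqVneq mu nu.
  by rewrite powR_conv_id ?(ltW (F0 _ nu0))// -mulrDl addrC subrK mul1r.
have [->|ln0] := eqVneq lam 0.
  by rewrite powRr0 subr0 powRr1 ?(ltW (F0 _ nu0))// mul0r add0r !mul1r.
have [->|ln1] := eqVneq lam 1.
  by rewrite subrr powRr0 powRr1 ?(ltW (F0 _ mu0))// mul0r addr0 mul1r mulr1.
by apply/ltW/FC; rewrite // lt_neqAle ?l0 ?l1 ?ln1 // eq_sym ln0.
Qed.

(** With [l = t / (s + t)], the point [mu + s] divides the interval from [mu]
    to [mu + s + t] in proportion [l], and [mu + t] in proportion [1 - l].
    Log-convexity bounds the first product by a weighted geometric mean of
    [F mu * G (mu + s + t)] and [G mu * F (mu + s + t)], and the second product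
    by the geometric mean with exchanged weights; the weights add up to 1 after
    the arithmetic-geometric mean inequality. *)
Lemma log_convex_pair F G mu s t :
  strictly_log_convex F -> strictly_log_convex G ->
  0 <= mu -> 0 <= s -> 0 <= t ->
  F (mu + s) * G (mu + t) + G (mu + s) * F (mu + t) <=
  F mu * G (mu + s + t) + G mu * F (mu + s + t).
Proof.
move=> FC GC mu0 s0 t0.
have [st0|stn0] := eqVneq (s + t) 0.
  have [-> ->] : s = 0 /\ t = 0 by split; lra.
  by rewrite !addr0.
have st_gt0 : 0 < s + t by rewrite lt_def stn0 addr_ge0.
pose l := t / (s + t).
have l0 : 0 <= l by rewrite divr_ge0// ltW.
have l1 : l <= 1 by rewrite ler_pdivrMr// mul1r lerDr.
have l1' : 1 - (1 - l) = l by ring.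
have nu0 : 0 <= mu + s + t by rewrite !addr_ge0.
have Es : mu + s = l * mu + (1 - l) * (mu + s + t) by rewrite /l; field.
have Et : mu + t = (1 - l) * mu + (1 - (1 - l)) * (mu + s + t).
  by rewrite /l; field.
have Fs := strictly_log_convexW FC mu0 nu0 l0 l1.
have Gs := strictly_log_convexW GC mu0 nu0 l0 l1.
have l'0 : 0 <= 1 - l by rewrite subr_ge0.
have l'1 : 1 - l <= 1 by rewrite gerBl.
have Ft := strictly_log_convexW FC mu0 nu0 l'0 l'1.
have Gt := strictly_log_convexW GC mu0 nu0 l'0 l'1.
rewrite -Es in Fs Gs; rewrite -Et l1' in Ft Gt.
have [F0 _] := FC; have [G0 _] := GC.
have mus : 0 <= mu + s by rewrite addr_ge0.
have mut : 0 <= mu + t by rewrite addr_ge0.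
set A := F mu in Fs Ft *; set B := F (mu + s + t) in Fs Ft *.
set C := G mu in Gs Gt *; set D := G (mu + s + t) in Gs Gt *.
have A0 : 0 <= A by rewrite ltW// F0.
have B0 : 0 <= B by rewrite ltW// F0.
have C0 : 0 <= C by rewrite ltW// G0.
have D0 : 0 <= D by rewrite ltW// G0.
have h1 : F (mu + s) * G (mu + t) <= l * (A * D) + (1 - l) * (B * C).
  apply: le_trans (weighted_amgm _ _ l0 l1); rewrite ?mulr_ge0//.
  apply: le_trans (ler_pM (ltW (F0 _ mus)) (ltW (G0 _ mut)) Fs Gt) _.
  by rewrite !powRM// le_eqVlt; apply/orP; left; apply/eqP; ring.
have h2 : G (mu + s) * F (mu + t) <= l * (C * B) + (1 - l) * (D * A).
  apply: le_trans (weighted_amgm _ _ l0 l1); rewrite ?mulr_ge0//.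
  apply: le_trans (ler_pM (ltW (G0 _ mus)) (ltW (F0 _ mut)) Gs Ft) _.
  by rewrite !powRM// le_eqVlt; apply/orP; left; apply/eqP; ring.
apply: le_trans (lerD h1 h2) _.
lra.
Qed.

Lemma rising_gt0 x n : 0 < x -> 0 < rising x n.
Proof. by move=> x0; apply: prodr_gt0 => i _; rewrite ltr_pwDl. Qed.

Lemma risingS x n : rising x n.+1 = rising x n * (x + n%:R).
Proof. by rewrite /rising big_ord_recr. Qed.

(** Each factor is affine in the base point, and affine functions are
    log-concave; log-concavity passes to products. *)
Lemma rising_log_concave x y lam n : 0 < x -> 0 < y -> 0 <= lam -> lam <= 1 ->
  rising x n `^ lam * rising y n `^ (1 - lam) <=
  rising (lam * x + (1 - lam) * y) n.
Proof.
move=> x0 y0 l0 l1; elim: n => [|n IH].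
  by rewrite /rising !big_ord0 !powR1 mul1r.
have xn : 0 < x + n%:R by rewrite ltr_pwDl.
have yn : 0 < y + n%:R by rewrite ltr_pwDl.
have := weighted_amgm (ltW xn) (ltW yn) l0 l1.
have -> : lam * (x + n%:R) + (1 - lam) * (y + n%:R) =
  lam * x + (1 - lam) * y + n%:R by ring.
rewrite !risingS !powRM ?(ltW xn) ?(ltW yn) ?(ltW (rising_gt0 n _))// => h.
by rewrite mulrACA ler_pM// mulr_ge0// powR_ge0.
Qed.

Definition gamma_ratio a c n mu : R := Gamma (a + mu + n%:R) / rising (c + mu) n.

Lemma gamma_ratio_strictly_log_convex a c n : 0 < a -> 0 < c ->
  strictly_log_convex (gamma_ratio a c n).
Proof.
move=> a0 c0.
have an mu : 0 <= mu -> 0 < a + mu + n%:R.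
  by move=> mu0; rewrite -addrA ltr_pwDl// addr_ge0.
have cn mu : 0 <= mu -> 0 < c + mu by move=> mu0; rewrite ltr_pwDl.
split=> [mu mu0|mu nu lam mu0 nu0 munu l0 l1].
  by rewrite divr_gt0 ?Gamma_gt0 ?rising_gt0 ?an ?cn.
have G0 := Gamma_gt0 (an _ mu0); have G1 := Gamma_gt0 (an _ nu0).
have r0 := rising_gt0 n (cn _ mu0); have r1 := rising_gt0 n (cn _ nu0).
rewrite /gamma_ratio !powR_div ?(ltW G0) ?(ltW G1)// mulf_div.
have Ea : a + (lam * mu + (1 - lam) * nu) + n%:R =
  lam * (a + mu + n%:R) + (1 - lam) * (a + nu + n%:R) by ring.
have Ec : c + (lam * mu + (1 - lam) * nu) =
  lam * (c + mu) + (1 - lam) * (c + nu) by ring.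
rewrite Ea Ec.
have rpos : 0 < rising (c + mu) n `^ lam * rising (c + nu) n `^ (1 - lam).
  by rewrite mulr_gt0// powR_gt0.
have := rising_log_concave n (cn _ mu0) (cn _ nu0) (ltW l0) (ltW l1).
set r := rising (_ * _ + _) n => rr.
apply: (@lt_le_trans _ _ (Gamma (a + mu + n%:R) `^ lam *
   Gamma (a + nu + n%:R) `^ (1 - lam) / r)).
  rewrite ltr_pM2r ?invr_gt0 ?(lt_le_trans rpos)//.
  apply: Gamma_conv_lt; rewrite ?an//.
  by apply: contra_neq munu => h; lra.
rewrite ler_wpM2l ?mulr_ge0 ?powR_ge0// lef_pV2 ?posrE//.
exact: lt_le_trans rr.
Qed.

Lemma rising_continuous x n : {for x, continuous (fun x => rising x n)}.
Proof.
elim: n => [|n IH].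
  rewrite (_ : (fun x => rising x 0) = cst 1); first exact: cst_continuous.
  by apply/funext => z; rewrite /rising big_ord0.
rewrite (_ : (fun x => rising x n.+1) = (fun x => rising x n * (x + n%:R))).
  by apply: cvgM; [exact: IH|apply: cvgD; [exact: cvg_id|exact: cvg_cst]].
by apply/funext => z; rewrite risingS.
Qed.

Lemma gamma_ratio_continuous a c n mu : 0 < a -> 0 < c -> 0 <= mu ->
  {for mu, continuous (gamma_ratio a c n)}.
Proof.
move=> a0 c0 mu0; apply: cvgM.
  have h : 0 < a + mu + n%:R by rewrite -addrA ltr_pwDl// addr_ge0.
  apply: (@continuous_comp _ _ _ (fun mu => a + mu + n%:R) (@Gamma R)).
    by apply: cvgD; [apply: cvgD; [exact: cvg_cst|exact: cvg_id]|exact: cvg_cst].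
  exact: Gamma_continuous.
have h : 0 < c + mu by rewrite ltr_pwDl.
apply: cvgV; first by rewrite gt_eqF// rising_gt0.
apply: (@continuous_comp _ _ _ (fun mu => c + mu) (fun x => rising x n)).
  by apply: cvgD; [exact: cvg_cst|exact: cvg_id].
exact: rising_continuous.
Qed.

Lemma fps_mulC (f g : nat -> R) n : fps_mul f g n = fps_mul g f n.
Proof.
rewrite /fps_mul (reindex_inj rev_ord_inj)/=.
apply: eq_bigr => i _; have le_in : (i <= n)%N by rewrite -ltnS.
by rewrite subSS subKn// mulrC.
Qed.

(** A single term of the convolution need not have a sign. Averaging the
    convolution with its reversal pairs index [i] with [n - i], and each pair is
    controlled by [log_convex_pair]. *)
Lemma fps_mul_log_convex_le (w : nat -> R) (F : nat -> R -> R)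
    (f : R -> nat -> R) mu s t n :
  (forall nu k, f nu k = w k * F k nu) ->
  (forall k, 0 <= w k) -> (forall k, strictly_log_convex (F k)) ->
  0 <= mu -> 0 <= s -> 0 <= t ->
  fps_mul (f (mu + s)) (f (mu + t)) n <= fps_mul (f mu) (f (mu + s + t)) n.
Proof.
move=> fE w0 FC mu0 s0 t0.
suff : fps_mul (f (mu + t)) (f (mu + s)) n + fps_mul (f (mu + s)) (f (mu + t)) n
    <= fps_mul (f (mu + s + t)) (f mu) n + fps_mul (f mu) (f (mu + s + t)) n.
  by rewrite fps_mulC [X in _ <= X + _]fps_mulC -!mulr2n lerMn2r.
rewrite /fps_mul -!big_split/=; apply: ler_sum => i _.
set j := (n - i)%N; rewrite !fE.
have := ler_wpM2l (mulr_ge0 (w0 i) (w0 j)) (log_convex_pair (FC i) (FC j) mu0 s0 t0).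
set L := _ * (_ + _); set L' := _ * (_ + _) => h.
have -> : w i * F i (mu + t) * (w j * F j (mu + s)) +
  w i * F i (mu + s) * (w j * F j (mu + t)) = L by rewrite /L; ring.
apply: (le_trans h); rewrite le_eqVlt; apply/orP; left; apply/eqP.
by rewrite /L'; ring.
Qed.

Lemma q_fpsE a c q mu n :
  q_fps a c q mu n = q n / n`!%:R * gamma_ratio a c n mu.
Proof. by rewrite /q_fps /gamma_ratio; ring. Qed.

Lemma q_fps_ge0 a c q mu n : 0 < a -> 0 < c -> (forall n, 0 <= q n) ->
  0 <= mu -> 0 <= q_fps a c q mu n.
Proof.
move=> a0 c0 q0 mu0; rewrite q_fpsE; apply: mulr_ge0; first by rewrite divr_ge0.
by apply: ltW; have [h _] := gamma_ratio_strictly_log_convex n a0 c0; exact: h.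
Qed.

Lemma q_fps_wright a c q : 0 < a -> 0 < c -> (forall n, 0 <= q n) ->
  wright_q_log_convex (q_fps a c q).
Proof.
move=> a0 c0 q0; split => [mu n|n|mu s t n mu0 s0 t0].
- exact: q_fps_ge0.
- apply: continuous_in_subspaceT => mu; rewrite inE/= in_itv/= andbT => mu0.
  rewrite (_ : (fun _ => _) = (fun mu => q n / n`!%:R * gamma_ratio a c n mu)).
    by apply: cvgM; [exact: cvg_cst|exact: gamma_ratio_continuous].
  by apply/funext => nu; rewrite q_fpsE.
- rewrite subr_le0.
  apply: (@fps_mul_log_convex_le (fun k => q k / k`!%:R) (gamma_ratio a c)) => //.
    by move=> nu k; rewrite q_fpsE.
    by move=> k; rewrite divr_ge0.
  by move=> k; exact: gamma_ratio_strictly_log_convex.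
Qed.

End LogConvexity.

(** * Series with nonnegative terms: Hoelder's inequality and Cauchy product *)

Section NonnegativeSeries.
Context {R : realType}.
Implicit Types (u v w : nat -> R) (l x y : R) (n : nat).

Lemma nneg_series_nd u : (forall n, 0 <= u n) -> nondecreasing_seq (series u).
Proof.
move=> u0; apply/nondecreasing_seqP => n.
by rewrite /series/= big_nat_recr//= lerDl.
Qed.

Lemma series_ge_term u n : (forall n, 0 <= u n) -> cvgn (series u) ->
  u n <= limn (series u).
Proof.
move=> u0 cu.
apply: le_trans (nondecreasing_cvgn_le (nneg_series_nd u0) cu n.+1).
by rewrite /series/= big_nat_recr//= lerDr sumr_ge0.
Qed.

Lemma series_lim_ge0 u : (forall n, 0 <= u n) -> cvgn (series u) ->
  0 <= limn (series u).
Proof. by move=> u0 /(series_ge_term 0 u0); apply: le_trans. Qed.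

(** The sum of the nonnegative differences is at least the one that is
    positive. *)
Lemma series_lt u v : (forall n, u n <= v n) -> (exists n, u n < v n) ->
  cvgn (series u) -> cvgn (series v) -> limn (series u) < limn (series v).
Proof.
move=> uv [n uvn] cu cv; rewrite -subr_gt0 -lim_seriesB//.
apply: (@lt_le_trans _ _ ((v - u) n)); first by rewrite subr_gt0.
apply: series_ge_term; last exact: is_cvg_seriesB.
by move=> k; rewrite subr_ge0.
Qed.

Section Hoelder.
Variables (u v w : nat -> R) (l : R).
Hypotheses (u0 : forall n, 0 <= u n) (v0 : forall n, 0 <= v n)
  (w0 : forall n, 0 <= w n) (l0 : 0 <= l) (l1 : l <= 1)
  (wuv : forall n, w n <= u n `^ l * v n `^ (1 - l))
  (cu : cvgn (series u)) (cv : cvgn (series v)).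
Let U := limn (series u).
Let V := limn (series v).

Let l10 : 0 <= 1 - l. Proof. by rewrite subr_ge0. Qed.

Lemma hoelder_series_cvg : cvgn (series w).
Proof.
apply: (@series_le_cvg _ _ (l *: u + (1 - l) *: v)) => //.
- by move=> n; rewrite addr_ge0// mulr_ge0.
- by move=> n; apply: le_trans (wuv n) _; exact: weighted_amgm.
- by apply: is_cvg_seriesD; exact: is_cvg_seriesZ.
Qed.

Let C := U `^ l * V `^ (1 - l).
Let z := (C * l / U) *: u + (C * (1 - l) / V) *: v.

Let cz : cvgn (series z).
Proof. by apply: is_cvg_seriesD; exact: is_cvg_seriesZ. Qed.

Let zE : U != 0 -> V != 0 -> limn (series z) = C.
Proof.
move=> Un Vn; rewrite lim_seriesD; [|exact: is_cvg_seriesZ|exact: is_cvg_seriesZ].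
rewrite !lim_seriesZ// /GRing.scale/= -/U -/V.
by move: C Un Vn => c; move: U V => r s rn sn; field; rewrite rn sn.
Qed.

Let wz n : 0 < U -> 0 < V -> u n `^ l * v n `^ (1 - l) <= z n.
Proof.
move=> U0 V0; apply: le_trans (hoelder_pointwise (u0 n) (v0 n) U0 V0 l0 l1) _.
have -> : z n = C * l / U * u n + C * (1 - l) / V * v n by [].
by rewrite -/C le_eqVlt; apply/orP; left; apply/eqP; ring.
Qed.

Lemma hoelder_series_lt : 0 < U -> 0 < V ->
  (exists n, w n < u n `^ l * v n `^ (1 - l)) -> limn (series w) < C.
Proof.
move=> U0 V0 [n wn]; rewrite -zE ?gt_eqF//; apply: series_lt => //.
- by move=> k; exact: le_trans (wz k U0 V0).
- by exists n; exact: lt_le_trans (wz n U0 V0).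
- exact: hoelder_series_cvg.
Qed.

Lemma hoelder_series : limn (series w) <= C.
Proof.
have cw := hoelder_series_cvg.
have [le0|ln0] := eqVneq l 0.
  rewrite /C le0 powRr0 subr0 mul1r powRr1 ?series_lim_ge0//.
  apply: lim_series_le => // n; apply: le_trans (wuv n) _.
  by rewrite le0 powRr0 subr0 mul1r powRr1.
have [le1|ln1] := eqVneq l 1.
  rewrite /C le1 subrr powRr0 mulr1 powRr1 ?series_lim_ge0//.
  apply: lim_series_le => // n; apply: le_trans (wuv n) _.
  by rewrite le1 subrr powRr0 mulr1 powRr1.
(* If [U] or [V] vanishes, normalization is impossible, but then every [w n] is 0. *)
have zero : (forall n, u n `^ l * v n `^ (1 - l) = 0) -> limn (series w) <= C.
  move=> h; apply: (@le_trans _ _ 0); last by rewrite mulr_ge0// powR_ge0.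
  apply: limr_le => //; apply: nearW => n; rewrite /series/= sumr_le0// => i _.
  by rewrite -(h i).
have [U0|Un] := eqVneq U 0.
  apply: zero => n; have /le_anti <- : 0 <= u n <= 0.
    by rewrite u0/= -U0 series_ge_term.
  by rewrite powR0// mul0r.
have [V0|Vn] := eqVneq V 0.
  apply: zero => n; have /le_anti <- : 0 <= v n <= 0.
    by rewrite v0/= -V0 series_ge_term.
  by rewrite (powR0 (x := 1 - l)) ?mulr0// subr_eq0 eq_sym.
have {}Un : 0 < U by rewrite lt_def Un series_lim_ge0.
have {}Vn : 0 < V by rewrite lt_def Vn series_lim_ge0.
rewrite -zE ?gt_eqF//; apply: lim_series_le => // n.
exact: le_trans (wz n Un Vn).
Qed.
End Hoelder.

(** The triangle [i + j < n] summed by rows. *)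
Lemma series_fps_mulE u v n :
  series (fps_mul u v) n = \sum_(i < n) u i * series v (n - i)%N.
Proof.
elim: n => [|n IH]; first by rewrite /series/= big_geq// big_ord0.
rewrite {1}/series/= big_nat_recr//= -[X in X + _]/(series _ n) IH /fps_mul.
rewrite [in RHS]big_ord_recr/= [in X in _ + X = _]big_ord_recr/= addrA -big_split/=.
have s1 : series v 1%N = v 0%N by rewrite /series/= big_nat1.
rewrite subnn subSnn s1; congr (_ + _).
apply: eq_bigr => i _; rewrite subSn 1?ltnW//.
by rewrite [series v _.+1]/series/= big_nat_recr//= mulrDr.
Qed.

(** The partial products are squeezed: the triangle of size [n] lies in the
    square of side [n], which lies in the triangle of size [n + n]. *)
Lemma cauchy_product_cvg u v : (forall n, 0 <= u n) -> (forall n, 0 <= v n) ->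
  cvgn (series u) -> cvgn (series v) ->
  series (fps_mul u v) @ \oo --> limn (series u) * limn (series v).
Proof.
move=> u0 v0 cu cv.
have m0 n : 0 <= fps_mul u v n by apply: sumr_ge0 => i _; rewrite mulr_ge0.
have ndu := nneg_series_nd u0; have ndv := nneg_series_nd v0.
have ndm := nneg_series_nd m0.
have sE n : series u n = \sum_(i < n) u i by rewrite /series/= big_mkord.
have su0 n : 0 <= series u n by rewrite sE sumr_ge0.
have sv0 n : 0 <= series v n by rewrite /series/= sumr_ge0.
have up n : series (fps_mul u v) n <= series u n * series v n.
  rewrite series_fps_mulE sE mulr_suml; apply: ler_sum => i _.
  by rewrite ler_wpM2l// ndv// leq_subr.
have lo n : series u n * series v n <= series (fps_mul u v) (n + n)%N.
  rewrite series_fps_mulE sE mulr_suml big_split_ord/=.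
  apply: (@le_trans _ _ (\sum_(i < n) u i * series v (n + n - i)%N)).
    apply: ler_sum => i _; rewrite ler_wpM2l// ndv// -addnBA ?leq_addr//.
    by rewrite ltnW.
  by rewrite lerDl sumr_ge0// => i _; rewrite mulr_ge0.
have ub n : series (fps_mul u v) n <= limn (series u) * limn (series v).
  apply: le_trans (up n) _; apply: ler_pM => //.
  - exact: nondecreasing_cvgn_le.
  - exact: nondecreasing_cvgn_le.
have cm : cvgn (series (fps_mul u v)).
  by apply: nondecreasing_is_cvgn => //; exists (limn (series u) * limn (series v))
    => _ [n _ <-].
have cuv : (fun n => series u n * series v n) @ \oo -->
  limn (series u) * limn (series v) by apply: cvgM.
suff -> : limn (series u) * limn (series v) = limn (series (fps_mul u v)) by [].
apply/eqP; rewrite eq_le; apply/andP; split.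
  rewrite -(cvg_lim _ cuv)//; apply: limr_le; first exact: cvgP cuv.
  by apply: nearW => n; apply: le_trans (lo n) _; exact: nondecreasing_cvgn_le.
by apply: limr_le => //; exact: nearW.
Qed.

End NonnegativeSeries.

(** * Power series with nonnegative coefficients *)

Section NonnegativePowerSeries.
Context {R : realType}.
Implicit Types (b f g : nat -> R) (x y z l : R) (n k : nat) (D : set R).

Lemma pseriesE f x : pseries f x = series (fun n => f n * x ^+ n).
Proof. by []. Qed.

(** The difference [y ^+ n.+1 - z ^+ n.+1] is [y - z] times a sum of [n.+1]
    monomials, each at least [z ^+ n]. This bounds the terms of the
    differentiated series at [z] by those of the original series at a larger
    [y]. *)
Lemma bernoulli_gap z y n : 0 <= z -> z <= y ->
  n.+1%:R * z ^+ n * (y - z) <= y ^+ n.+1.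
Proof.
move=> z0 zy; have y0 : 0 <= y by exact: le_trans zy.
suff : n.+1%:R * z ^+ n * (y - z) + z ^+ n.+1 <= y ^+ n.+1.
  by apply: le_trans; rewrite lerDl exprn_ge0.
elim: n => [|n IH]; first by rewrite !expr1 expr0 !mul1r subrK.
rewrite (exprS y); apply: le_trans (ler_wpM2l y0 IH).
have gap : 0 <= (y - z) * (n.+1%:R * z ^+ n * (y - z)).
  by rewrite !mulr_ge0 ?subr_ge0// exprn_ge0.
rewrite -subr_ge0; apply: le_trans gap _; rewrite le_eqVlt; apply/orP; left.
have -> : n.+2%:R = n.+1%:R + 1 :> R by rewrite natr1.
by apply/eqP; rewrite !exprS; ring.
Qed.

Lemma pseries_diffs_cvg b z y : (forall n, 0 <= b n) -> 0 <= z -> z < y ->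
  cvgn (pseries b y) -> cvgn (pseries (pseries_diffs b) z).
Proof.
move=> b0 z0 zy cb; have yz : 0 < y - z by rewrite subr_gt0.
have y0 : 0 <= y by rewrite (le_trans z0)// ltW.
pose u n := b n * y ^+ n.
have u0 n : 0 <= u n by rewrite mulr_ge0// exprn_ge0.
have cs : cvgn (series (fun n => u n.+1)).
  apply: nondecreasing_is_cvgn; first exact: nneg_series_nd.
  exists (limn (series u)) => _ [n _ <-].
  apply: le_trans (nondecreasing_cvgn_le (nneg_series_nd u0) cb n.+1).
  by rewrite /series/= big_nat_recl//= lerDr.
apply: (@series_le_cvg _ _ ((y - z)^-1 *: (fun n => u n.+1))).
- by move=> n; rewrite mulr_ge0 ?exprn_ge0// mulr_ge0.
- by move=> n; rewrite mulr_ge0 ?u0// invr_ge0 ltW.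
- move=> n; rewrite /pseries_diffs /u.
  have -> : ((y - z)^-1 *: (fun n => b n.+1 * y ^+ n.+1)) n =
    (b n.+1 * y ^+ n.+1) / (y - z) by rewrite [RHS]mulrC.
  rewrite ler_pdivlMr//.
  have := ler_wpM2l (b0 n.+1) (bernoulli_gap n z0 (ltW zy)).
  by apply: le_trans => /=; rewrite le_eqVlt; apply/orP; left; apply/eqP; ring.
- exact: is_cvg_seriesZ.
Qed.

Lemma iter_diffs_ge0 b k n : (forall n, 0 <= b n) ->
  0 <= iter k (@pseries_diffs R) b n.
Proof.
by move=> b0; elim: k n => [//|k IH] n; rewrite iterS mulr_ge0.
Qed.

Lemma iter_diffs_cvg b k z y : (forall n, 0 <= b n) -> 0 <= z -> z < y ->
  cvgn (pseries b y) -> cvgn (pseries (iter k (@pseries_diffs R) b) z).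
Proof.
move=> b0 + + cb; elim: k z => [|k IH] z z0 zy.
  apply: is_cvg_pseries_inside cb _.
  by rewrite !ger0_norm// (le_trans z0)// ltW.
pose m := (z + y) / 2.
have zm : z < m by rewrite /m; lra.
have my : m < y by rewrite /m; lra.
apply: (@pseries_diffs_cvg _ z m) => //.
  by move=> n; exact: iter_diffs_ge0.
by apply: IH => //; rewrite (le_trans z0)// ltW.
Qed.

Lemma pseries_ge0 b x : (forall n, 0 <= b n) -> 0 <= x -> cvgn (pseries b x) ->
  0 <= limn (pseries b x).
Proof.
by move=> b0 x0; apply: series_lim_ge0 => n; rewrite mulr_ge0// exprn_ge0.
Qed.

(** The positivity clause places [D] in the positive half line, where all terms
    of the series are nonnegative; convergence is required at every point of
    [D], including an end point of the interval of convergence. *)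
Definition represented_on D b (phi : R -> R) :=
  forall x, D x -> [/\ 0 < x, cvgn (pseries b x) & phi x = limn (pseries b x)].

Lemma interior_lt D x : D° x -> exists2 y, D y & x < y.
Proof.
move=> /nbhs_ballP[e /= e0 eD]; exists (x + e / 2); last by rewrite ltrDl divr_gt0.
apply: eD; rewrite /ball/= opprD addNKr normrN gtr0_norm ?divr_gt0//.
by rewrite ltr_pdivrMr// ltr_pMr// ltr1n.
Qed.

(** Each interior point lies strictly below some point of [D], where the
    original series converges; below that point all the differentiated series
    converge. The equality with the iterated derivative then holds near the
    point, which is what the next differentiation needs. *)
Lemma represented_derive1n D b phi k x :
  (forall n, 0 <= b n) -> represented_on D b phi -> D° x ->
  derive1n k phi x = limn (pseries (iter k (@pseries_diffs R) b) x) /\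
  is_derive x 1 (derive1n k phi)
    (limn (pseries (iter k.+1 (@pseries_diffs R) b) x)).
Proof.
move=> b0 rep.
have step j z : D° z ->
    (forall t, D° t ->
      derive1n j phi t = limn (pseries (iter j (@pseries_diffs R) b) t)) ->
    is_derive z 1 (derive1n j phi)
      (limn (pseries (iter j.+1 (@pseries_diffs R) b) z)).
  move=> Dz E.
  have [y Dy zy] := interior_lt Dz.
  have [_ cy _] := rep _ Dy.
  have [z0 _ _] := rep _ (interior_subset Dz).
  pose m := (z + y) / 2.
  have zm : z < m by rewrite /m; lra.
  have my : m < y by rewrite /m; lra.
  have m0 : 0 < m by exact: lt_trans zm.
  have c i : cvgn (pseries (iter i (@pseries_diffs R) b) m).
    by apply: iter_diffs_cvg my cy => //; exact: ltW.
  apply: (@near_eq_is_derive _ _ _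
    (fun t => limn (pseries (iter j (@pseries_diffs R) b) t))).
    near=> t; rewrite E//; near: t.
    by apply: open_nbhs_nbhs; split => //; exact: open_interior.
  apply: (@pseries_snd_diffs _ _ m); [exact: c|exact: (c j.+1)|exact: (c j.+2)|].
  by rewrite !gtr0_norm.
have val j : forall z, D° z ->
    derive1n j phi z = limn (pseries (iter j (@pseries_diffs R) b) z).
  elim: j => [z Dz|j IH z Dz].
    by rewrite derive1n0; have [_ _ ->] := rep _ (interior_subset Dz).
  rewrite derive1nS derive1E.
  by have /@derive_val := step j z Dz IH.
by move=> Dx; split; [exact: val|apply: step => //; exact: val].
Unshelve. all: by end_near. Qed.

Lemma represented_absolutely_monotonic D b phi :
  (forall n, 0 <= b n) -> represented_on D b phi -> absolutely_monotonic D phi.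
Proof.
move=> b0 rep; split=> [x /rep[x0 cx ->]|n x Dx].
  by apply: pseries_ge0 => //; exact: ltW.
have [_ /@ex_derive dn] := represented_derive1n n b0 rep Dx.
have [-> _] := represented_derive1n n.+1 b0 rep Dx.
have [y Dy xy] := interior_lt Dx.
have [_ cy _] := rep _ Dy.
have [x0 _ _] := rep _ (interior_subset Dx).
split; first exact: dn.
apply: pseries_ge0; [|exact: ltW|].
  by move=> m; exact: iter_diffs_ge0.
by apply: iter_diffs_cvg xy cy => //; exact: ltW.
Qed.

Lemma term_geometric_mean (r : R) x y l n : 0 <= r -> 0 <= x -> 0 <= y ->
  r * (x `^ l * y `^ (1 - l)) ^+ n =
  (r * x ^+ n) `^ l * (r * y ^+ n) `^ (1 - l).
Proof.
move=> r0 x0 y0; have X (z s : R) : 0 <= z -> (z ^+ n) `^ s = (z `^ s) ^+ n.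
  by move=> z0; rewrite -(powR_mulrn n z0) powRAC powR_mulrn// powR_ge0.
rewrite !powRM ?exprn_ge0// !X// exprMn mulrACA.
by rewrite powR_conv_id.
Qed.

Lemma pseries_geometric_mean_cvg b x y l : (forall n, 0 <= b n) ->
  0 <= x -> 0 <= y -> 0 <= l -> l <= 1 ->
  cvgn (pseries b x) -> cvgn (pseries b y) ->
  cvgn (pseries b (x `^ l * y `^ (1 - l))).
Proof.
move=> b0 x0 y0 l0 l1 cx cy.
apply: (@hoelder_series_cvg _ (fun n => b n * x ^+ n) (fun n => b n * y ^+ n) _ l)
  => // n /=.
- by rewrite mulr_ge0// exprn_ge0.
- by rewrite mulr_ge0// exprn_ge0.
- by rewrite mulr_ge0// exprn_ge0// mulr_ge0 ?powR_ge0.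
- by rewrite term_geometric_mean.
Qed.

(** A monomial with nonnegative coefficient is multiplicatively affine
    ([term_geometric_mean]); Hoelder's inequality sums these identities. *)
Lemma represented_multiplicatively_convex D b phi :
  (forall n, 0 <= b n) -> represented_on D b phi ->
  (forall x y l, D x -> D y -> 0 <= l -> l <= 1 -> D (x `^ l * y `^ (1 - l))) ->
  multiplicatively_convex D phi.
Proof.
move=> b0 rep Dgm; split=> [x /rep[x0 cx ->]|x y l Dx Dy l0 l1].
  by apply: pseries_ge0 => //; exact: ltW.
have [x0 cx ->] := rep _ Dx; have [y0 cy ->] := rep _ Dy.
have [_ _ ->] := rep _ (Dgm _ _ _ Dx Dy l0 l1).
apply: (@hoelder_series _ (fun n => b n * x ^+ n) (fun n => b n * y ^+ n) _ l)
  => // n /=.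
- by rewrite mulr_ge0// exprn_ge0// ltW.
- by rewrite mulr_ge0// exprn_ge0// ltW.
- by rewrite mulr_ge0// exprn_ge0// mulr_ge0 ?powR_ge0.
- by rewrite term_geometric_mean// ltW.
Qed.

Lemma pseries_fps_mul_cvg f g x : (forall n, 0 <= f n) -> (forall n, 0 <= g n) ->
  0 <= x -> cvgn (pseries f x) -> cvgn (pseries g x) ->
  pseries (fps_mul f g) x @ \oo --> limn (pseries f x) * limn (pseries g x).
Proof.
move=> f0 g0 x0 cf cg.
have -> : pseries (fps_mul f g) x =
    series (fps_mul (fun n => f n * x ^+ n) (fun n => g n * x ^+ n)).
  rewrite pseriesE; congr series; apply/funext => n.
  rewrite /fps_mul mulr_suml; apply: eq_bigr => i _.
  have le_in : (i <= n)%N by rewrite -ltnS.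
  by rewrite mulrACA -exprD subnKC.
by apply: cauchy_product_cvg => // n; rewrite mulr_ge0// exprn_ge0.
Qed.

End NonnegativePowerSeries.

(** * The series in gamma ratios *)

Section GammaRatioSeries.
Context {R : realType}.
Variables (a c : R) (q : nat -> R).
Hypotheses (a0 : 0 < a) (c0 : 0 < c) (q0 : forall n, 0 <= q n).
Implicit Types (x y mu nu l : R) (n : nat).

(** Hoelder's inequality for the series at [mu] and [nu]; it is strict because
    the term of an index with [q n != 0] is strictly log-convex. *)
Lemma q_fun_strictly_log_convex x : (exists n, q n != 0) ->
  conv_interval a c q x -> strictly_log_convex (fun mu => q_fun a c q mu x).
Proof.
move=> [n0 qn0] [x0 cx].
pose K n := q n / n`!%:R * x ^+ n.
have K0 n : 0 <= K n by rewrite mulr_ge0 ?divr_ge0// exprn_ge0// ltW.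
have Kn0 : 0 < K n0.
  by rewrite mulr_gt0 ?exprn_gt0// divr_gt0 ?ltr0n ?fact_gt0// lt_def qn0/=.
have termE mu n : q_fps a c q mu n * x ^+ n = K n * gamma_ratio a c n mu.
  by rewrite q_fpsE mulrAC.
have GR n := gamma_ratio_strictly_log_convex n a0 c0.
have g0 n mu : 0 <= mu -> 0 < gamma_ratio a c n mu by have [h _] := GR n; exact: h.
have t0 mu n : 0 <= mu -> 0 <= q_fps a c q mu n * x ^+ n.
  by move=> mu0; rewrite termE mulr_ge0// ltW// g0.
have pos mu : 0 <= mu -> 0 < q_fun a c q mu x.
  move=> mu0; apply: lt_le_trans (series_ge_term n0 (fun n => t0 mu n mu0) (cx _ mu0)).
  by rewrite termE mulr_gt0// g0.
split=> // mu nu l mu0 nu0 munu l0 l1.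
have mid0 : 0 <= l * mu + (1 - l) * nu.
  by rewrite addr_ge0// mulr_ge0// ?subr_ge0 ltW.
have mixE n : (K n * gamma_ratio a c n mu) `^ l *
    (K n * gamma_ratio a c n nu) `^ (1 - l) =
    K n * (gamma_ratio a c n mu `^ l * gamma_ratio a c n nu `^ (1 - l)).
  rewrite (powRM _ (K0 n) (ltW (g0 n mu mu0))) (powRM _ (K0 n) (ltW (g0 n nu nu0))).
  by rewrite mulrACA powR_conv_id.
apply: (@hoelder_series_lt _ (fun n => q_fps a c q mu n * x ^+ n)
  (fun n => q_fps a c q nu n * x ^+ n)
  (fun n => q_fps a c q (l * mu + (1 - l) * nu) n * x ^+ n) l) => //=.
- by move=> n; exact: t0.
- by move=> n; exact: t0.
- by move=> n; exact: t0.
- exact: ltW.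
- exact: ltW.
- move=> n; rewrite !termE mixE ler_wpM2l//.
  by apply: strictly_log_convexW (GR n) _ _ _ _ => //; exact: ltW.
- exact: cx.
- exact: cx.
- exact: pos.
- exact: pos.
- exists n0; rewrite !termE mixE ltr_pM2l//.
  by have [_ h] := GR n0; exact: h.
Qed.

Lemma rho_fps_le0 mu nu n : 0 <= mu -> 0 <= nu -> rho_fps a c q mu nu n <= 0.
Proof.
move=> mu0 nu0; have [_ _ h] := q_fps_wright a0 c0 q0.
by have := h 0 mu nu n (lexx _) mu0 nu0; rewrite !add0r.
Qed.

Lemma rho_fun_represented mu nu : 0 <= mu -> 0 <= nu ->
  represented_on (conv_interval a c q) (fun n => - rho_fps a c q mu nu n)
    (fun x => - rho_fun a c q mu nu x).
Proof.
move=> mu0 nu0 x [x0 cx].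
have munu0 : 0 <= mu + nu by rewrite addr_ge0.
have f0 t : 0 <= t -> forall n, 0 <= q_fps a c q t n.
  by move=> ? n; exact: q_fps_ge0.
have P s t s0 t0 := pseries_fps_mul_cvg (f0 s s0) (f0 t t0) (ltW x0) (cx s s0) (cx t t0).
have h : pseries (fun n => - rho_fps a c q mu nu n) x @ \oo -->
    - rho_fun a c q mu nu x.
  rewrite /rho_fun opprB.
  have -> : pseries (fun n => - rho_fps a c q mu nu n) x =
      pseries (fps_mul (q_fps a c q 0) (q_fps a c q (mu + nu))) x
      - pseries (fps_mul (q_fps a c q mu) (q_fps a c q nu)) x.
    apply/funext => n; rewrite [RHS]/GRing.add/= /pseries/series/= -sumrB.
    by apply: eq_bigr => i _; rewrite -mulrBl /rho_fps opprB.
  exact: cvgB (P 0 (mu + nu) (lexx _) munu0) (P mu nu mu0 nu0).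
split=> //; first exact: cvgP h.
by rewrite (cvg_lim _ h).
Qed.

(** Needed to evaluate [- rho_fun] at a geometric mean through its power
    series. *)
Lemma conv_interval_geometric_mean x y l :
  conv_interval a c q x -> conv_interval a c q y -> 0 <= l -> l <= 1 ->
  conv_interval a c q (x `^ l * y `^ (1 - l)).
Proof.
move=> [x0 cx] [y0 cy] l0 l1; split; first by rewrite mulr_gt0 ?powR_gt0.
move=> mu mu0; apply: pseries_geometric_mean_cvg => //.
- by move=> n; exact: q_fps_ge0.
- exact: ltW.
- exact: ltW.
- exact: cx.
- exact: cy.
Qed.

End GammaRatioSeries.

Unset Implicit Arguments.

Theorem theorem6 (R : realType) (a c : R) (q : nat -> R)
    (ha : 0 < a) (hc : 0 < c) (hq : forall n, 0 <= q n) :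
  [/\ (exists n, q n != 0) ->
        forall x, conv_interval a c q x ->
          strictly_log_convex (fun mu => q_fun a c q mu x),
      wright_q_log_convex (q_fps a c q)
    & forall mu nu : R, 0 <= mu -> 0 <= nu ->
        [/\ forall n, rho_fps a c q mu nu n <= 0,
            absolutely_monotonic (conv_interval a c q)
              (fun x => - rho_fun a c q mu nu x)
          & multiplicatively_convex (conv_interval a c q)
              (fun x => - rho_fun a c q mu nu x)]].
Proof.
split=> [q_neq0 x||mu nu mu0 nu0].
- exact: q_fun_strictly_log_convex.
- exact: q_fps_wright.
have b0 n : 0 <= - rho_fps a c q mu nu n by rewrite oppr_ge0 rho_fps_le0.
have rep := rho_fun_represented ha hc hq mu0 nu0.
split=> [n||].
- exact: rho_fps_le0.
- exact: represented_absolutely_monotonic rep.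
- apply: represented_multiplicatively_convex rep _ => // x y l.
  exact: conv_interval_geometric_mean.
Qed.
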